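(* Let $X$ be a Banach space with norm $\|\cdot\|_X$, let $Q$ be a countable index set and, for every $j\in Q$, let $t\mapsto T_j(t)$, $t\ge 0$, be a strongly continuous semigroup of bounded linear operators on $X$. Consider the switched system $$x(t_{k+1}) = T_{\sigma(t_k)}(t_{k+1}-t_k)\,x(t_k),\quad k\in\mathbb{N},\qquad x(0)=x_0\in X,$$ with $x(t)=T_{\sigma(t_k)}(t-t_k)x(t_k)$ for $t\in(t_k,t_{k+1})$, where $\sigma\colon[0,\infty)\to Q$ is a piecewise constant right-continuous switching signal with switching times $0=t_0<t_1<\dots<t_k<\cdots$. Then the following three conditions are equivalent: (A) There exist two constants $K\ge 1$ and $\mu>0$ such that, for every switching signal $\sigma(\cdot)$ and every $x_0\in X$, the solution $x(\cdot)$ of the switched system satisfies $$\|x(t)\|_X\le K e^{-\mu t}\|x_0\|_X,\quad t\ge 0.$$ (B) There exist two constants $M\ge 1$ and $\omega>0$ such that, for every switching signal $\sigma(\cdot)$ and every $x_0\in X$, the solution $x(\cdot)$ of the switched system satisfies $$\|x(t)\|_X\le M e^{\omega t}\|x_0\|_X,\quad t\ge 0,$$ and there exists $V\colon X\to[0,\infty)$ such that $\sqrt{V(\cdot)}$ is a norm on $X$, $$V(x)\le C\|x\|_X^2,\quad x\in X,$$ for a constant $C>0$, and $$\liminf_{t\downarrow 0}\frac{V(T_j(t)x)-V(x)}{t}\le -\|x\|_X^2,\quad j\in Q,\ x\in X.$$ (C) There exists $V\colon X\to[0,\infty)$ such that $\sqrt{V(\cdot)}$ is a norm on $X$, $$c\|x\|_X^2\le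 V(x)\le C\|x\|_X^2,\quad x\in X,$$ for some constants $c,C>0$, and $$\liminf_{t\downarrow 0}\frac{V(T_j(t)x)-V(x)}{t}\le -\|x\|_X^2,\quad j\in Q,\ x\in X.$$
   Context: Piecewise constant switching signals have only finitely many switching times in each bounded interval; all such signals with values in $Q$ are allowed. The $\liminf$ in the decay condition is allowed to be $-\infty$. The constants in (A) and (B) do not depend on $\sigma(\cdot)$ or $x_0$. *)

(* Defs.v *)
From HB Require Import structures.
From mathcomp Require Import all_boot all_order all_algebra.
From mathcomp Require Import all_classical all_reals all_analysis.
From mathcomp Require Import complex.

Set Implicit Arguments.
Unset Strict Implicit.
Unset Printing Implicit Defensive.

Import Order.TTheory GRing.Theory Num.Theory.
Import numFieldNormedType.Exports.

Local Open Scope classical_set_scope.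
Local Open Scope ring_scope.

(* Banach spaces are taken over the real or over the complex numbers. *)
Variant scalars := RealScalars | ComplexScalars.

Definition scalar_field (R : realType) (k : scalars) : numFieldType :=
  match k with
  | RealScalars => R : numFieldType
  | ComplexScalars => (R[i])%C : numFieldType
  end.

Definition scalar_re (R : realType) (k : scalars) : scalar_field R k -> R :=
  match k return scalar_field R k -> R with
  | RealScalars => id
  | ComplexScalars => @complex.Re R
  end.

(* A norm in MathComp takes its values in the field of scalars, so that over
   R[i] it is a nonnegative element of R[i]; these are the same modulus and
   norm, seen as elements of R. *)
Definition scalar_abs (R : realType) (k : scalars) (a : scalar_field R k) : R :=
  scalar_re `|a|.

Definition rnorm (R : realType) (k : scalars)
    (X : normedModType (scalar_field R k)) (x : X) : R :=
  scalar_re `|x|.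

Section SwitchedSystem.
Context {R : realType} {k : scalars} {X : normedModType (scalar_field R k)}.

Definition bounded_linear_operator (f : X -> X) : Prop :=
  linear f /\ exists C : R, forall x, rnorm (f x) <= C * rnorm x.

(* Semigroups are indexed by [0, +oo[: the values T t for t < 0 are
   unconstrained. *)
Record strongly_continuous_semigroup (T : R -> X -> X) : Prop := {
  semigroup_bounded_linear : forall t, 0 <= t -> bounded_linear_operator (T t);
  semigroup0 : forall x, T 0 x = x;
  semigroupD : forall s t, 0 <= s -> 0 <= t ->
    forall x, T (s + t) x = T s (T t x);
  semigroup_cvg0 : forall x, T t x @[t --> 0^'+] --> x }.

(* The condition tau --> +oo says that there are finitely many switching times
   in each bounded interval. Two consecutive values of sigma may coincide, so
   that signals with finitely many jumps, e.g. constant ones, are included. *)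
Record switching_times (Q : Type) (sigma : R -> Q) (tau : R^nat) : Prop := {
  switching_times0 : tau 0%N = 0;
  switching_times_lt : forall n, tau n < tau n.+1;
  switching_times_cvg : tau n @[n --> \oo] --> +oo;
  switching_times_const : forall n t, tau n <= t < tau n.+1 ->
    sigma t = sigma (tau n) }.

(* Signals are defined on [0, +oo[: the values at negative times play no
   role. *)
Definition switching_signal (Q : Type) (sigma : R -> Q) : Prop :=
  exists tau : R^nat, switching_times sigma tau.

Definition switched_solution (Q : Type) (T : Q -> R -> X -> X)
    (sigma : R -> Q) (x0 : X) (x : R -> X) : Prop :=
  exists tau : R^nat, [/\ switching_times sigma tau,
    x 0 = x0,
    forall n, x (tau n.+1) =
      T (sigma (tau n)) (tau n.+1 - tau n) (x (tau n)) &
    forall n t, tau n < t < tau n.+1 ->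
      x t = T (sigma (tau n)) (t - tau n) (x (tau n))].

Definition exponential_bound (Q : Type) (T : Q -> R -> X -> X) (K r : R) :
    Prop :=
  forall sigma : R -> Q, switching_signal sigma ->
  forall (x0 : X) (x : R -> X), switched_solution T sigma x0 x ->
  forall t, 0 <= t -> rnorm (x t) <= K * expR (r * t) * rnorm x0.

Definition is_norm (N : X -> R) : Prop :=
  [/\ forall x, 0 <= N x,
      forall x, N x = 0 -> x = 0,
      forall (a : scalar_field R k) x, N (a *: x) = scalar_abs a * N x &
      forall x y, N (x + y) <= N x + N y].

(* The liminf is taken in the extended reals, hence may be -oo. *)
Definition decay_condition (Q : Type) (T : Q -> R -> X -> X) (V : X -> R) :
    Prop :=
  forall (j : Q) (x : X),
    (limf_einf (fun t : R => ((V (T j t x) - V x) / t)%:E) (0 : R)^'+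
     <= (- rnorm x ^+ 2)%:E)%E.

End SwitchedSystem.

(* Main.v *)
Require Import Defs.
From HB Require Import structures.
From mathcomp Require Import all_boot all_order all_algebra.
From mathcomp Require Import all_classical all_reals all_analysis.
From mathcomp Require Import complex zify ring lra.

Set Implicit Arguments.
Unset Strict Implicit.
Unset Printing Implicit Defensive.

Import Order.TTheory GRing.Theory Num.Theory.
Import numFieldNormedType.Exports.

Local Open Scope classical_set_scope.
Local Open Scope ring_scope.

(** Every bound in the theorem concerns the products
    T_(j_n)(s_n) o ... o T_(j_1)(s_1), with s_i >= 0, and the time
    s_1 + ... + s_n that they take: a solution at time t is such a product of
    total time t applied to x0, and each product is the value of a solution
    ([exponential_boundE]). Signals are therefore replaced by words, finite
    sequences of pairs (j, s), on which [flow T w] acts by composition. The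
    equivalence follows from the cycle (A) => (C) => (B) => (A).

    (A) => (C). The norm N x = sup_w e^(mu |w|) |flow T w x|, where |w| is the
    duration of w, satisfies |x| <= N x <= K |x| and
    N (T_j(h) x) <= e^(- mu h) N x, since prepending (j, h) to a word prolongs it
    by h. Differentiating at h = 0 shows that V = N^2 / (2 mu) satisfies the
    decay condition, even with N x in the place of |x|.

    (C) => (B). Along t |-> T_j(t) x the function V is lower semicontinuous from
    the left, and the decay condition bounds its lower right Dini derivative by
    - |T_j(t) x|^2; so V decreases along words, and c |.|^2 <= V <= C |.|^2
    turns this into a bound on the flow.

    (B) => (A). This is an argument of Datko type without integrals. If every
    word of duration at most h has norm at most A, then each point y of the path
    from x to z = flow T w x, with |w| <= h, satisfies |y| >= |z| / A, so that V
    decreases at rate at least |z|^2 / A^2 on the whole path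
    ([lyapunov_flow_decrease]):
      A^2 V z + |w| |z|^2 <= A^2 V x <= A^2 C |x|^2.
    Taken over the last unit of time, where the growth bound provides A, this
    bounds all words uniformly; taken then over a long time with the uniform
    bound, it shows that long words are contractions, whence exponential decay.

    The left semicontinuity of V uses that each semigroup is bounded on bounded
    intervals, a consequence of the uniform boundedness principle. Its
    proof by nested balls ([condensation_of_singularities]) treats real and
    complex scalars at once. *)

(** * The norm as a real number *)

Section RealNorm.
Context {R : realType} {k : scalars}.

Definition real_scalar : R -> scalar_field R k :=
  match k return R -> scalar_field R k with
  | RealScalars => id
  | ComplexScalars => fun a => (a%:C)%C
  end.

Lemma scalar_reK : cancel real_scalar (@scalar_re R k).
Proof. by rewrite /real_scalar /scalar_re; case: k. Qed.

Lemma real_scalar_ltE a b : (real_scalar a < real_scalar b) = (a < b).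
Proof. by rewrite /real_scalar; case: k => //=; rewrite ltcR. Qed.

Lemma real_scalar_leE a b : (real_scalar a <= real_scalar b) = (a <= b).
Proof. by rewrite /real_scalar; case: k => //=; rewrite lecR. Qed.

Lemma real_scalar0 : real_scalar 0 = 0.
Proof. by rewrite /real_scalar; case: k. Qed.

Lemma real_scalarD a b : real_scalar (a + b) = real_scalar a + real_scalar b.
Proof. by rewrite /real_scalar; case: k => //=; rewrite rmorphD. Qed.

Lemma real_scalarM a b : real_scalar (a * b) = real_scalar a * real_scalar b.
Proof. by rewrite /real_scalar; case: k => //=; rewrite rmorphM. Qed.

(** A nonnegative complex number, in the order of R[i], has zero imaginary part. *)
Lemma real_scalarE (a : scalar_field R k) :
  0 <= a -> a = real_scalar (scalar_re a).
Proof.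
rewrite /real_scalar /scalar_re; move: a; case: k => //= a a0.
by rewrite RRe_real// ger0_real.
Qed.

Lemma scalar_absE (a : scalar_field R k) : `|a| = real_scalar (scalar_abs a).
Proof. by rewrite -real_scalarE. Qed.

Lemma real_scalar_inj : injective real_scalar.
Proof. exact: can_inj scalar_reK. Qed.

Lemma scalar_abs_real_scalar a : scalar_abs (real_scalar a) = `|a|.
Proof.
apply: real_scalar_inj; rewrite -scalar_absE.
have [a0|a0] := leP 0 a.
  by rewrite !ger0_norm// -real_scalar0 real_scalar_leE.
have e : real_scalar (- a) = - real_scalar a.
  by apply/eqP; rewrite -addr_eq0 -real_scalarD addNr real_scalar0.
by rewrite (ltr0_norm a0) e ler0_norm// -real_scalar0 real_scalar_leE ltW.
Qed.

Lemma scalar_abs_ge0 (a : scalar_field R k) : 0 <= scalar_abs a.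
Proof. by rewrite -real_scalar_leE -scalar_absE real_scalar0. Qed.

Lemma scalar_absV (a : scalar_field R k) : a != 0 ->
  scalar_abs a * scalar_abs a^-1 = 1.
Proof.
move=> a0; apply: real_scalar_inj.
rewrite real_scalarM -!scalar_absE -normrM divff// normr1.
by rewrite /real_scalar; case: k.
Qed.

Context {X : normedModType (scalar_field R k)}.
Implicit Types x y : X.

Lemma rnormE x : `|x| = real_scalar (rnorm x).
Proof. exact: real_scalarE. Qed.

Lemma rnorm_ge0 x : 0 <= rnorm x.
Proof. by rewrite -real_scalar_leE -rnormE real_scalar0. Qed.

Lemma rnorm0 : rnorm (0 : X) = 0.
Proof. by apply: real_scalar_inj; rewrite -rnormE normr0 real_scalar0. Qed.

Lemma rnorm0_eq0 x : rnorm x = 0 -> x = 0.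
Proof. by move=> x0; apply/normr0_eq0; rewrite rnormE x0 real_scalar0. Qed.

Lemma rnormZ (a : scalar_field R k) x : rnorm (a *: x) = scalar_abs a * rnorm x.
Proof.
by apply: real_scalar_inj; rewrite real_scalarM -scalar_absE -!rnormE normrZ.
Qed.

Lemma rnormN x : rnorm (- x) = rnorm x.
Proof. by rewrite /rnorm normrN. Qed.

Lemma ler_rnormD x y : rnorm (x + y) <= rnorm x + rnorm y.
Proof. by rewrite -real_scalar_leE real_scalarD -!rnormE ler_normD. Qed.

Lemma rnormB x y : rnorm (x - y) = rnorm (y - x).
Proof. by rewrite /rnorm distrC. Qed.

Lemma rnorm_cvg_right (f : R -> X) (a : R) l : f t @[t --> a^'+] --> l ->
  forall e, 0 < e -> exists2 d, 0 < d &
    forall h, 0 < h -> h < d -> rnorm (f (a + h) - l) < e.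
Proof.
move=> /cvgrPdist_lt fl e e0.
have /fl : 0 < real_scalar e by rewrite -real_scalar0 real_scalar_ltE.
move=> [d /= d0 H]; exists d => // h h0 hd.
have := H (a + h); rewrite rnormE real_scalar_ltE rnormB; apply.
  by rewrite /= opprD addNKr normrN gtr0_norm.
by rewrite ltrDl.
Qed.

End RealNorm.

Section Complete.
Context {R : realType} {k : scalars} {X : completeNormedModType (scalar_field R k)}.

Lemma rnorm_complete (u : nat -> X) :
  (forall e, 0 < e -> exists n, forall m, (n <= m)%N -> rnorm (u n - u m) < e) ->
  exists l, forall e, 0 < e ->
    exists n, forall m, (n <= m)%N -> rnorm (l - u m) < e.
Proof.
move=> cu.
have : cvg (u @ \oo).
  apply: cauchy_cvg; apply: cauchy_exP => e e0.
  have [n un] : exists n, forall m, (n <= m)%N -> rnorm (u n - u m) < scalar_re e.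
    by apply: cu; rewrite -(real_scalar_ltE (k := k)) -real_scalarE ?ltW// real_scalar0.
  exists (u n), n => // m /un /=; rewrite -ball_normE /=.
  by rewrite rnormE (real_scalarE (ltW e0)) real_scalar_ltE scalar_reK.
rewrite cvg_ex => -[l /cvgrPdist_lt ul]; exists l => e e0.
have /ul : 0 < real_scalar (k := k) e by rewrite -real_scalar0 real_scalar_ltE.
move=> [n _ H]; exists n => m /H /=.
by rewrite rnormE real_scalar_ltE.
Qed.
End Complete.

(** * Uniform boundedness *)

Section BanachSteinhaus.
Context {R : realType} {k : scalars}.

Section Operators.
Context {X : normedModType (scalar_field R k)}.
Variable f : X -> X.
Hypothesis bf : bounded_linear_operator f.

Lemma bounded_linearD x y : f (x + y) = f x + f y.
Proof. by have [lf _] := bf; rewrite -[x in LHS]scale1r lf scale1r. Qed.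

Lemma bounded_linear0 : f 0 = 0.
Proof. by apply: (addrI (f 0)); rewrite -bounded_linearD !addr0. Qed.

Lemma bounded_linearZ a x : f (a *: x) = a *: f x.
Proof.
by have [lf _] := bf; rewrite -[a *: x]addr0 lf bounded_linear0 addr0.
Qed.

Lemma bounded_linearB x y : f (x - y) = f x - f y.
Proof. by rewrite -scaleN1r bounded_linearD bounded_linearZ scaleN1r. Qed.

Lemma bounded_linear_gt0 :
  exists2 C : R, 0 < C & forall x, rnorm (f x) <= C * rnorm x.
Proof.
have [_ [C fC]] := bf; exists (`|C| + 1); first by rewrite ltr_wpDl.
move=> x; apply: (le_trans (fC x)); rewrite ler_wpM2r ?rnorm_ge0//.
by rewrite (le_trans (ler_norm _))// lerDl.
Qed.
End Operators.

(** By linearity f takes a value larger than c + 1 at x or at x + v, where v is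
    the multiple of y of norm r / 2; by continuity it stays above c on a small
    ball around that point. *)
Lemma gliding_hump_step (X : normedModType (scalar_field R k))
    (f : X -> X) (c r : R) (x y : X) :
  bounded_linear_operator f -> 0 < r ->
  4 * (c + 1) / r * rnorm y < rnorm (f y) ->
  exists p : X * R, [/\ 0 < p.2, p.2 <= r / 2, rnorm (p.1 - x) <= r / 2 &
    forall z, rnorm (z - p.1) <= p.2 -> c < rnorm (f z)].
Proof.
move=> bf r0 fy.
have y0 : 0 < rnorm y.
  rewrite lt_neqAle rnorm_ge0 andbT; apply/eqP => /esym y0.
  by move: fy; rewrite y0 (rnorm0_eq0 y0) (bounded_linear0 bf) rnorm0 mulr0 ltxx.
have [C C0 fC] := bounded_linear_gt0 bf.
pose v := real_scalar (k := k) (r / 2 / rnorm y) *: y.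
have r20 : 0 < r / 2 by rewrite divr_gt0.
have v2 : rnorm v = r / 2.
  by rewrite rnormZ scalar_abs_real_scalar gtr0_norm ?divr_gt0// divfK ?gt_eqF.
have fv : 2 * (c + 1) < rnorm (f v).
  rewrite (bounded_linearZ bf) rnormZ scalar_abs_real_scalar.
  rewrite gtr0_norm ?divr_gt0// mulrAC ltr_pdivlMr//.
  rewrite -ltr_pdivrMl//; suff -> : (r / 2)^-1 * (2 * (c + 1) * rnorm y) =
    4 * (c + 1) / r * rnorm y by [].
  by field; rewrite gt_eqF.
(* |f (x + v)| + |f x| >= |f v| > 2 (c + 1), so one of them exceeds c + 1. *)
have [x' [x'r x'c]] : exists x', rnorm (x' - x) <= r / 2 /\ c + 1 < rnorm (f x').
  have [fx|fx] := ltP (c + 1) (rnorm (f x)).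
    by exists x; rewrite subrr rnorm0 ltW.
  exists (x + v); rewrite addrAC subrr add0r v2; split => //.
  have := ler_rnormD (f (x + v)) (- f x).
  rewrite rnormN (bounded_linearD bf) addrAC subrr add0r -(bounded_linearD bf).
  lra.
exists (x', Num.min (r / 2) C^-1) => /=; split => //.
- by rewrite lt_min r20 invr_gt0.
- by rewrite ge_min lexx.
- move=> z; rewrite le_min => /andP[_ zC].
  have fzx : rnorm (f (x' - z)) <= 1.
    by rewrite (le_trans (fC _))// rnormB mulrC -ler_pdivlMr// mul1r.
  have := ler_rnormD (f (x' - z)) (f z).
  rewrite (bounded_linearB bf) subrK -(bounded_linearB bf); lra.
Qed.

Context {X : completeNormedModType (scalar_field R k)}.

(** The uniform boundedness principle, in the contrapositive form suited to
    operators T t with t tending to 0: if every L n is unbounded in operator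
    norm, then a single x witnesses it for all n. It is the common point of
    nested balls, the n-th of which is produced by an operator of L n. *)
Lemma condensation_of_singularities (L : nat -> set (X -> X)) :
  (forall n f, L n f -> bounded_linear_operator f) ->
  (forall n M, exists2 f, L n f & exists y, M * rnorm y < rnorm (f y)) ->
  exists x, forall n, exists2 f, L n f & n%:R < rnorm (f x).
Proof.
move=> bL uL.
have step (a : nat * (X * R)) : exists p, 0 < a.2.2 ->
    [/\ 0 < p.2, p.2 <= a.2.2 / 2, rnorm (p.1 - a.2.1) <= a.2.2 / 2 &
      exists2 f, L a.1 f &
        forall z, rnorm (z - p.1) <= p.2 -> a.1%:R < rnorm (f z)].
  case: a => n [x r] /=; have [r0|_] := ltP 0 r; last by exists (x, r).
  have [f Lf [y fy]] := uL n (4 * (n%:R + 1) / r).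
  have [p [p0 pr px pf]] := gliding_hump_step x (bL _ _ Lf) r0 fy.
  by exists p => _; split => //; exists f.
have [F HF] := choice step.
(* p n is the centre and the radius of the n-th ball. *)
pose fix p n := if n is m.+1 then F (m, p m) else (0, 1).
have p0 n : 0 < (p n).2 by elim: n => //= n IH; have [] := HF (n, p n) IH.
have pS n := HF (n, p n) (p0 n).
have ball_nested n m : (n <= m)%N ->
    rnorm ((p n).1 - (p m).1) + (p m).2 <= (p n).2.
  elim: m => [|m IH]; first by rewrite leqn0 => /eqP ->; rewrite subrr rnorm0 add0r.
  rewrite leq_eqVlt => /orP[/eqP ->|]; first by rewrite subrr rnorm0 add0r.
  rewrite ltnS => /IH; have [_ /= r' x' _] := pS m.
  have := ler_rnormD ((p n).1 - (p m).1) ((p m).1 - (F (m, p m)).1).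
  rewrite addrA subrK rnormB [rnorm ((p m).1 - _)]rnormB /=.
  rewrite [rnorm ((p n).1 - _)]rnormB; rewrite [rnorm ((F _).1 - (p n).1)]rnormB.
  rewrite [rnorm ((p m).1 - (p n).1)]rnormB; lra.
(* Radii are at least halved at each step, hence are at most 1 / (n + 1). *)
have pn1 n : (p n).2 * n.+1%:R <= 1.
  elim: n => [|n IH]; first by rewrite mulr1.
  have [_ /= r' _ _] := pS n; apply: le_trans IH.
  have : (F (n, p n)).2 * n.+2%:R <= (p n).2 / 2 * n.+2%:R by rewrite ler_wpM2r.
  move/le_trans; apply; rewrite -mulrA ler_wpM2l ?(ltW (p0 _))//.
  rewrite mulrC ler_pdivrMr// -natrM ler_nat; lia.
have [|l Hl] := rnorm_complete (u := fun n => (p n).1).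
  move=> e e0; have [n ne] : exists n, n.+1%:R^-1 < e.
    exists (Num.truncn e^-1).
    by rewrite -ltf_pV2 ?(posrE,divr_gt0)// ?invr_gt0// invrK truncnS_gt.
  exists n => m nm; apply: le_lt_trans ne.
  have := ball_nested n m nm; have := p0 m; have := pn1 n.
  rewrite -ler_pdivlMr// mul1r => rn r0 rnm; apply: le_trans rn.
  apply: le_trans rnm; by rewrite lerDl ltW.
exists l => n; have [_ _ _ [f Lf fl]] := pS n; exists f => //.
apply: fl; rewrite -/(p n.+1); apply/ler_addgt0Pr => e e0.
have [m Hm] := Hl e e0; have := Hm _ (leq_maxl m n.+1).
have := ball_nested _ _ (leq_maxr m n.+1); have := p0 (maxn m n.+1).
have := ler_rnormD (l - (p (maxn m n.+1)).1) ((p (maxn m n.+1)).1 - (p n.+1).1).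
rewrite addrA subrK [rnorm ((p (maxn _ _)).1 - _)]rnormB; lra.
Qed.

End BanachSteinhaus.

(** * Strongly continuous semigroups and Dini derivatives *)

Section Semigroup.
Context {R : realType} {k : scalars} {X : normedModType (scalar_field R k)}.
Variable T : R -> X -> X.
Hypothesis hT : strongly_continuous_semigroup T.

Lemma semigroup_near0 (x : X) (e : R) : 0 < e -> exists2 d, 0 < d &
  forall h, 0 <= h -> h < d -> rnorm (T h x - x) < e.
Proof.
move=> e0; have [d d0 H] := rnorm_cvg_right (@semigroup_cvg0 _ _ _ _ hT x) e0.
exists d => // h; rewrite le_eqVlt => /predU1P[<- _|h0 hd].
  by rewrite (semigroup0 hT) subrr rnorm0.
by have := H h h0 hd; rewrite add0r.
Qed.

End Semigroup.

Section CompleteSemigroup.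
Context {R : realType} {k : scalars} {X : completeNormedModType (scalar_field R k)}.
Variable T : R -> X -> X.
Hypothesis hT : strongly_continuous_semigroup T.

(** Otherwise some x has T t x of arbitrarily large norm for arbitrarily small
    t, although T t x tends to x. *)
Lemma semigroup_bounded_near0 : exists2 d : R, 0 < d & exists M : R, forall t,
  0 <= t <= d -> forall x, rnorm (T t x) <= M * rnorm x.
Proof.
apply: contrapT => nobound.
pose L n := [set T t | t in [set t : R | 0 <= t <= n.+1%:R^-1]].
have [||x Hx] := condensation_of_singularities (L := L).
- by move=> n f [t /andP[t0 _] <-]; exact: (semigroup_bounded_linear hT).
- move=> n M; apply: contrapT => noy; apply: nobound.
  exists n.+1%:R^-1 => //; exists M => t tn x.
  rewrite leNgt; apply/negP => Mx; apply: noy.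
  by exists (T t); [exists t | exists x].
have [d d0 Hd] := semigroup_near0 hT x ltr01.
pose n := maxn (Num.truncn d^-1) (Num.truncn (rnorm x + 1)).+1.
have [f [t /= /andP[t0 tn] <-] nf] := Hx n.
have td : t < d.
  apply: (le_lt_trans tn); rewrite -ltf_pV2 ?posrE// invrK.
  by rewrite (lt_le_trans (truncnS_gt _))// ler_nat ltnS leq_maxl.
have := Hd t t0 td; have := ler_rnormD (T t x - x) x; rewrite subrK.
have : rnorm x + 1 < n%:R.
  by rewrite (lt_le_trans (truncnS_gt _))// ler_nat leq_maxr.
lra.
Qed.

(** An interval of length d n is crossed in n steps of length at most d. *)
Lemma semigroup_bounded (s : R) : exists2 M, 0 <= M & forall t,
  0 <= t <= s -> forall x, rnorm (T t x) <= M * rnorm x.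
Proof.
have [d d0 [M HM]] := semigroup_bounded_near0.
have iter n : exists2 B, 1 <= B & forall t,
    0 <= t <= d * n%:R -> forall x, rnorm (T t x) <= B * rnorm x.
  elim: n => [|n [B B1 HB]].
    exists 1 => // t; rewrite mulr0 -eq_le => /eqP <- x.
    by rewrite (semigroup0 hT) mul1r.
  have M1 (x : X) : M * rnorm x <= (`|M| + 1) * rnorm x.
    by rewrite ler_wpM2r ?rnorm_ge0// (le_trans (ler_norm M))// lerDl.
  exists (B * (`|M| + 1)) => [|t /andP[t0 tn] x].
    by rewrite mulr_ege1// lerDr.
  have [td|td] := leP t d.
    apply: (le_trans (HM _ _ x)); first by rewrite t0.
    apply: (le_trans (M1 x)); rewrite ler_wpM2r ?rnorm_ge0//.
    by rewrite ler_peMl// addr_ge0.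
  rewrite -[t](subrK d) (semigroupD hT) ?subr_ge0 ?(ltW td) ?(ltW d0)//.
  apply: (le_trans (HB _ _ _)).
    rewrite subr_ge0 (ltW td)/= lerBlDr (le_trans tn)//.
    by rewrite -natr1 mulrDr mulr1.
  rewrite -mulrA ler_wpM2l//; first exact: le_trans B1.
  by apply: le_trans (M1 x); rewrite HM// lexx ltW.
have [B B1 HB] := iter (Num.truncn (s / d)).+1; exists B => [|t /andP[t0 ts]].
  exact: le_trans B1.
apply: HB; rewrite t0 (le_trans ts)// mulrC -ler_pdivrMr//.
by rewrite ltW// truncnS_gt.
Qed.

(** T t x - T r x = T r (T (t - r) x - x), and T r is bounded uniformly in r. *)
Lemma semigroup_left_continuous (x : X) (t e : R) : 0 < t -> 0 < e ->
  exists2 d, 0 < d & forall r, 0 <= r -> t - d < r -> r < t -> rnorm (T t x - T r x) < e.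
Proof.
move=> t0 e0; have [M M0 HM] := semigroup_bounded t.
have M1 : 0 < M + 1 by rewrite ltr_wpDl.
have [d d0 Hd] := semigroup_near0 hT x (divr_gt0 e0 M1).
exists d => // r r0 tdr rt.
have rt' : 0 <= t - r by rewrite subr_ge0 ltW.
have -> : T t x = T r (T (t - r) x) by rewrite -(semigroupD hT)// addrC subrK.
have bT := semigroup_bounded_linear hT r0.
rewrite -(bounded_linearB bT); apply: (le_lt_trans (HM _ _ _)).
  by rewrite r0 ltW.
have : rnorm (T (t - r) x - x) < e / (M + 1) by apply: Hd => //; lra.
rewrite ltr_pdivlMr// mulrC; apply: le_lt_trans.
by rewrite ler_wpM2r ?rnorm_ge0// lerDl.
Qed.

End CompleteSemigroup.

Section Dini.
Context {R : realType}.
Implicit Types (g q : R -> R).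

(** The supremum of the points where g is at most g 0 is such a point, by left
    lower semicontinuity, and cannot be smaller than s. *)
Lemma le_of_recurrent_decrease g (s : R) : 0 <= s ->
  (forall t, 0 < t <= s -> forall e, 0 < e -> exists2 d, 0 < d &
    forall r, 0 <= r -> t - d < r -> r < t -> g t - e < g r) ->
  (forall t, 0 <= t < s -> forall d, 0 < d ->
    exists h, [/\ 0 < h, h < d & g (t + h) <= g t]) ->
  g s <= g 0.
Proof.
move=> s0 lsc dec.
pose S := [set t | 0 <= t <= s /\ g t <= g 0].
have S0 : S 0 by split; rewrite ?lexx.
have hS : has_sup S by split; [exists 0 | exists s => t [/andP[]]].
set m := sup S.
have mS (t : R) : S t -> t <= m by move=> St; exact: (ub_le_sup (proj2 hS)).
have m0 : 0 <= m by exact: mS.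
have ms : m <= s by apply: ge_sup; [exists 0 | move=> t [/andP[]]].
have gm : g m <= g 0.
  rewrite leNgt; apply/negP => gm.
  have m_gt0 : 0 < m.
    by rewrite lt_neqAle m0 andbT; apply/eqP => m0'; move: gm; rewrite -m0' ltxx.
  have tm : 0 < m <= s by rewrite m_gt0.
  have ge : 0 < g m - g 0 by rewrite subr_gt0.
  have [d d0 Hd] := lsc m tm _ ge.
  have [r Sr mdr] := sup_adherent d0 hS.
  have [/andP[r0 _] gr] := Sr.
  have rm : r < m.
    rewrite lt_neqAle (mS _ Sr) andbT; apply/eqP => e.
    by move: gr; rewrite e leNgt gm.
  by have := Hd r r0 mdr rm; rewrite opprB addrC subrK ltNge gr.
move: ms; rewrite le_eqVlt => /predU1P[<-//|ms].
have ms' : 0 <= m < s by rewrite m0.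
have sm0 : 0 < s - m by rewrite subr_gt0.
have [h [h0 hs gh]] := dec m ms' _ sm0.
have : S (m + h).
  by split; [rewrite addr_ge0 ?(ltW h0)//= addrC -lerBrDr ltW | exact: le_trans gm].
by move=> /mS; rewrite gerDl leNgt h0.
Qed.

(** Stated with values of q at small h, since the lower limit may be -oo. *)
Lemma liminf_right_leP q (a : R) :
  (limf_einf (fun t => (q t)%:E) (0 : R)^'+ <= a%:E)%E <->
  forall e d, 0 < e -> 0 < d -> exists h, [/\ 0 < h, h < d & q h < a + e].
Proof.
rewrite limf_einfE; split => [qa e d e0 d0|H].
  apply: contrapT => noh.
  suff /le_trans/(_ qa) : ((a + e)%:E <=
      ereal_sup [set ereal_inf ((fun t => (q t)%:E) @` V) | V in (0 : R)^'+])%E.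
    by rewrite lee_fin gerDl leNgt e0.
  apply: (@le_trans _ _ (ereal_inf ((fun t => (q t)%:E) @` [set t | 0 < t < d]))).
    apply: le_ereal_inf_tmp => _ [t /andP[t0 td] <-]; rewrite lee_fin leNgt.
    by apply/negP => qt; apply: noh; exists t.
  apply: ereal_sup_ubound; exists [set t | 0 < t < d] => //.
  exists d => // t /=; rewrite sub0r normrN => td t0 /=.
  by rewrite t0 (le_lt_trans (ler_norm _)).
apply: ge_ereal_sup => _ [A [d /= d0 dA] <-].
apply/lee_addgt0Pr => e e0.
have [h [h0 hd qh]] := H e d e0 d0.
apply: (@le_trans _ _ (q h)%:E); last by rewrite -EFinD lee_fin ltW.
apply: ereal_inf_lbound; exists h => //; apply: dA => //=.
by rewrite sub0r normrN gtr0_norm.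
Qed.

End Dini.

(** * Words and switched solutions *)

Section Words.
Context {R : realType} {Q : Type}.
Implicit Types w : seq (Q * R).

Definition admissible w : bool := all (fun p : Q * R => 0 <= p.2) w.

Definition duration w : R := \sum_(p <- w) p.2.

Definition flow (X : Type) (T : Q -> R -> X -> X) w (x : X) : X :=
  foldl (fun y (p : Q * R) => T p.1 p.2 y) x w.

Lemma duration_nil : duration [::] = 0. Proof. exact: big_nil. Qed.

Lemma duration_cons p w : duration (p :: w) = p.2 + duration w.
Proof. exact: big_cons. Qed.

Lemma duration_cat w1 w2 : duration (w1 ++ w2) = duration w1 + duration w2.
Proof. exact: big_cat. Qed.

Lemma duration_ge0 w : admissible w -> 0 <= duration w.
Proof.
elim: w => [|p w IH] /=; first by rewrite duration_nil.
by move=> /andP[p0 /IH w0]; rewrite duration_cons addr_ge0.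
Qed.

End Words.

Section Flow.
Context {R : realType} {k : scalars} {X : normedModType (scalar_field R k)}.
Context {Q : Type} {T : Q -> R -> X -> X}.
Hypothesis hT : forall j, strongly_continuous_semigroup (T j).
Implicit Types (w : seq (Q * R)) (x y : X).

Lemma flow_cat w1 w2 x : flow T (w1 ++ w2) x = flow T w2 (flow T w1 x).
Proof. exact: foldl_cat. Qed.

Lemma flowD w x y : admissible w -> flow T w (x + y) = flow T w x + flow T w y.
Proof.
elim: w x y => //= -[j s] w IH x y /andP[s0 /IH {}IH].
by rewrite (bounded_linearD (semigroup_bounded_linear (hT j) s0)) IH.
Qed.

Lemma flowZ w a x : admissible w -> flow T w (a *: x) = a *: flow T w x.
Proof.
elim: w x => //= -[j s] w IH x /andP[s0 /IH {}IH].
by rewrite (bounded_linearZ (semigroup_bounded_linear (hT j) s0)) IH.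
Qed.

(** The letter (j, s) of w that is in progress at time r is cut in two. *)
Lemma flow_split w (r : R) : admissible w -> 0 <= r <= duration w ->
  exists w1 w2, [/\ admissible w1, admissible w2, duration w1 = r,
    duration w = duration w1 + duration w2 &
    forall x, flow T w x = flow T w2 (flow T w1 x)].
Proof.
elim: w r => [|[j s] w IH] r /=.
  move=> _; rewrite duration_nil -eq_le => /eqP <-.
  by exists [::], [::]; rewrite duration_nil addr0.
move=> /andP[/= s0 aw]; rewrite duration_cons/= => /andP[r0 rs].
have [sr|rs'] := leP s r.
  have [|w1 [w2 [a1 a2 d1 dw f12]]] := IH (r - s) aw.
    by rewrite subr_ge0 sr lerBlDl.
  exists ((j, s) :: w1), w2; rewrite duration_cons/=; split => //.
  - by rewrite s0.
  - by rewrite d1 addrC subrK.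
  - by rewrite dw addrA.
exists [:: (j, r)], ((j, s - r) :: w).
rewrite !duration_cons /= duration_nil; split => //.
- by rewrite r0.
- by rewrite subr_ge0 ltW.
- by rewrite addr0.
- by rewrite addr0 addrA [r + _]addrC subrK.
- by move=> x; rewrite -(semigroupD (hT j)) ?subrK// subr_ge0 ltW.
Qed.

Definition flow_bound (K r : R) : Prop := forall w, admissible w ->
  forall x, rnorm (flow T w x) <= K * expR (r * duration w) * rnorm x.

(** The word lists the values of the signal between consecutive switching times,
    up to t. *)
Lemma switched_solution_flow (sigma : R -> Q) x0 (x : R -> X) (t : R) :
  switched_solution T sigma x0 x -> 0 <= t ->
  exists w, [/\ admissible w, duration w = t & x t = flow T w x0].
Proof.
move=> [tau [[tau0 tau_lt tau_cvg _] x00 x_switch x_between]] t0.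
have [n tn] : exists n, t <= tau n.
  have /cvgryPge/(_ t)[n _ Hn] := tau_cvg.
  by exists n; apply: Hn => /=.
elim: n t t0 tn => [|n IH] t t0 tn.
  exists [::]; rewrite duration_nil; split => //.
    by apply/eqP; rewrite eq_le t0 -tau0 tn.
  by have -> : t = 0 by apply/eqP; rewrite eq_le t0 -tau0 tn.
have [tn'|tn'] := leP t (tau n); first exact: IH.
have taun0 : 0 <= tau n.
  rewrite -tau0; elim: {IH tn tn'} n => // n IH.
  exact: le_trans IH (ltW (tau_lt n)).
have [w [aw dw xw]] := IH _ taun0 (lexx _).
exists (rcons w (sigma (tau n), t - tau n)); split.
- by rewrite /admissible all_rcons /= subr_ge0 (ltW tn').
- by rewrite -cats1 duration_cat dw duration_cons duration_nil addr0 addrC subrK.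
- rewrite -cats1 flow_cat /= -xw.
  move: tn; rewrite le_eqVlt => /predU1P[->|tn]; first exact: x_switch.
  by apply: x_between; rewrite tn'.
Qed.

(** The integers serve as switching times, at which nothing changes. *)
Lemma constant_solution (j : Q) x :
  switched_solution T (fun=> j) x (fun t => T j t x).
Proof.
exists (fun n => n%:R); split => //.
- split => //.
  + by move=> n; rewrite ltr_nat.
  + apply/cvgryPge => A; exists (Num.truncn A).+1 => // n /= An.
    by rewrite ltW// (lt_le_trans (truncnS_gt _))// ler_nat.
- exact: (semigroup0 (hT j)).
- by move=> n; rewrite -(semigroupD (hT j)) ?subrK// subr_ge0 ler_nat.
- move=> n t /andP[/ltW nt _].
  by rewrite -(semigroupD (hT j)) ?subrK// subr_ge0.
Qed.

(** The switching times are 0 followed by those of sigma delayed by s. *)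
Lemma prepend_solution (j : Q) (s : R) (sigma : R -> Q) x (y : R -> X) :
  0 < s -> switched_solution T sigma (T j s x) y ->
  switched_solution T (fun t => if t < s then j else sigma (t - s)) x
    (fun t => if t < s then T j t x else y (t - s)).
Proof.
move=> s0 [tau [[tau0 tau_lt tau_cvg tau_const] y0 y_switch y_between]].
have tau_ge0 n : 0 <= tau n.
  by rewrite -tau0; elim: n => // n /le_trans; apply; exact: ltW.
have s_tau n : (tau n + s < s) = false.
  by apply/negbTE; rewrite -leNgt lerDr.
exists (fun n => if n is m.+1 then tau m + s else 0); split.
- split => //.
  + by case=> [|n]; rewrite ?tau0 ?add0r// ltrD2r.
  + apply/cvgryPge => A; have /cvgryPge/(_ A)[n _ Hn] := tau_cvg.
    exists n.+1 => // -[|m] //= nm; apply: le_trans (Hn m nm) _.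
    by rewrite lerDl ltW.
  + case=> [|n] t /andP[t1 t2].
      by move: t2; rewrite tau0 add0r => ->; rewrite s0.
    rewrite s_tau addrK ifF; last first.
      by apply/negbTE; rewrite -leNgt (le_trans _ t1)// lerDr.
    by apply: tau_const; rewrite lerBrDr t1 ltrBlDr.
- by rewrite s0 (semigroup0 (hT j)).
- case=> [|n]; first by rewrite tau0 add0r ltxx subrr y0 s0 subr0 (semigroup0 (hT j)).
  by rewrite !s_tau !addrK y_switch opprD addrACA subrr addr0.
- case=> [|n] t /andP[t1 t2].
    by move: t2; rewrite tau0 add0r s0 => ->; rewrite subr0 (semigroup0 (hT j)).
  rewrite s_tau addrK ifF; last first.
    by apply/negbTE; rewrite -leNgt (le_trans _ (ltW t1))// lerDr.
  rewrite (y_between n (t - s)); first by rewrite opprD addrA addrAC.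
  by rewrite ltrBrDr t1 ltrBlDr.
Qed.

(** Letters of zero duration act as the identity and are dropped; after the last
    letter the signal stays at j for ever. *)
Lemma flow_switched_solution (j : Q) w x : admissible w ->
  exists sigma (y : R -> X),
    switched_solution T sigma x y /\ y (duration w) = flow T w x.
Proof.
elim: w x => [|[i s] w IH] x /=.
  move=> _; exists (fun=> j), (fun t => T j t x); split.
    exact: constant_solution.
  by rewrite duration_nil (semigroup0 (hT j)).
move=> /andP[/= s0 aw]; have [sigma [y [sy yw]]] := IH (T i s x) aw.
rewrite duration_cons/=; move: s0; rewrite le_eqVlt => /predU1P[se|s0].
  by exists sigma, y; move: sy yw; rewrite -se (semigroup0 (hT i)) add0r.
exists (fun t => if t < s then i else sigma (t - s)).
exists (fun t => if t < s then T i t x else y (t - s)).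
split; first exact: prepend_solution.
by rewrite gtrDl ltNge duration_ge0//= [s + _]addrC addrK yw.
Qed.

(** The empty word, which yields no signal when Q is empty, satisfies the bound
    because 1 <= K. *)
Lemma exponential_boundE (K r : R) : 1 <= K ->
  exponential_bound T K r <-> flow_bound K r.
Proof.
move=> K1; split => [eb w aw x|fb sigma _ x0 x xs t t0]; last first.
  by have [w [aw <- ->]] := switched_solution_flow xs t0; exact: fb.
case: w aw => [|[j s] w] aw.
  by rewrite duration_nil mulr0 expR0 mulr1 ler_peMl ?rnorm_ge0.
have [sigma [y [sy <-]]] := flow_switched_solution j x aw.
apply: (eb sigma) => //; last exact: duration_ge0.
by have [tau [tauP _ _ _]] := sy; exists tau.
Qed.

End Flow.
Arguments flow_bound {R k X Q} T K r.

(** * Decrease of the Lyapunov function *)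

(** Continuity of the square, made explicit: b^2 - a^2 <= 2 b (b - a). *)
Lemma sqr_lower_bound (R : realType) (a b e : R) : 0 <= a -> 0 <= b -> 0 < e ->
  b - a < e / (2 * b + 1) -> b ^+ 2 - e < a ^+ 2.
Proof.
move=> a0 b0 e0; have b1 : 0 < 2 * b + 1 by lra.
have [ba _|ab] := leP b a; first nra.
rewrite ltr_pdivlMr// => bae; nra.
Qed.

Section Lyapunov.
Context {R : realType} {k : scalars} {X : completeNormedModType (scalar_field R k)}.
Context {Q : Type} {T : Q -> R -> X -> X}.
Hypothesis hT : forall j, strongly_continuous_semigroup (T j).
Variables (V : X -> R) (C : R).
Hypothesis V_ge0 : forall x, 0 <= V x.
Hypothesis V_norm : is_norm (fun x => Num.sqrt (V x)).
Hypothesis C_gt0 : 0 < C.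
Hypothesis V_le : forall x, V x <= C * rnorm x ^+ 2.
Hypothesis V_decay : decay_condition T V.
Implicit Types (w : seq (Q * R)) (x y : X).

Let N x := Num.sqrt (V x).

(** As a norm bounded by sqrt C |.|, the function sqrt V is Lipschitz. *)
Lemma sqrt_lyapunovB x y : N x - N y <= Num.sqrt C * rnorm (x - y).
Proof.
have [_ _ _ ND] := V_norm; have := ND (x - y) y; rewrite subrK -/(N x) -/(N y).
have : N (x - y) <= Num.sqrt C * rnorm (x - y).
  rewrite /N (le_trans (ler_wsqrtr (V_le _)))//.
  by rewrite sqrtrM ?(ltW C_gt0)// sqrtr_sqr ger0_norm ?rnorm_ge0.
rewrite -/(N (x - y)); lra.
Qed.

Lemma lyapunov_semigroup_lsc j x (t e : R) : 0 < t -> 0 < e ->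
  exists2 d : R, 0 < d & forall r : R, 0 <= r -> t - d < r -> r < t ->
    V (T j t x) - e < V (T j r x).
Proof.
move=> t0 e0; have C1 : 0 < Num.sqrt C by rewrite sqrtr_gt0.
have b0 : 0 < 2 * N (T j t x) + 1 by rewrite ltr_wpDl// mulr_ge0// sqrtr_ge0.
have [d d0 Hd] :=
  semigroup_left_continuous (hT j) x t0 (divr_gt0 (divr_gt0 e0 b0) C1).
exists d => // r r0 tdr rt.
rewrite -(sqr_sqrtr (V_ge0 (T j t x))) -(sqr_sqrtr (V_ge0 (T j r x))).
apply: sqr_lower_bound; rewrite ?sqrtr_ge0//.
apply: (le_lt_trans (sqrt_lyapunovB _ _)).
by have := Hd r r0 tdr rt; rewrite ltr_pdivlMr// mulrC.
Qed.

(** For q > 0 the function V (T_j(t) x) + (L - q) t has negative lower right Dini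
    derivative; then q tends to 0. *)
Lemma lyapunov_semigroup_decrease j (s L : R) x : 0 <= s ->
  (forall t, 0 <= t < s -> L <= rnorm (T j t x) ^+ 2) ->
  V (T j s x) + L * s <= V x.
Proof.
move=> s0 HL; apply/ler_addgt0Pr => e e0.
have s1 : 0 < s + 1 by rewrite ltr_wpDl.
pose q := e / (s + 1); have q0 : 0 < q by rewrite divr_gt0.
pose g t := V (T j t x) + (L - q) * t.
have : g s <= g 0.
  apply: le_of_recurrent_decrease => //.
  - move=> t /andP[t0 ts] eta eta0.
    have [d d0 Hd] := lyapunov_semigroup_lsc j x t0 (divr_gt0 eta0 (ltr0Sn R 1)).
    have l0 : 0 < `|L - q| + 1 by rewrite ltr_wpDl.
    pose d' := eta / 2 / (`|L - q| + 1).
    have d'0 : 0 < d' by rewrite !divr_gt0.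
    exists (Num.min d d'); first by rewrite lt_min d0.
    move=> r r0 tr rt; have tdr : t - d < r.
      by rewrite (le_lt_trans _ tr)// lerB// ge_min lexx.
    have := Hd r r0 tdr rt.
    have : t - d' < r by rewrite (le_lt_trans _ tr)// lerB// ge_min lexx orbT.
    rewrite ltrBlDr addrC -ltrBlDr ltr_pdivlMr// => trd.
    have : (L - q) * (t - r) <= (t - r) * (`|L - q| + 1).
      by rewrite mulrC ler_wpM2l ?subr_ge0 ?(ltW rt)// (le_trans (ler_norm _))// lerDl.
    rewrite /g; lra.
  - move=> t /andP[t0 ts] d d0.
    (* The decay condition at the point T_j(t) x gives the step h. *)
    have /liminf_right_leP/(_ q d q0 d0) := V_decay j (T j t x).
    move=> [h [h0 hd]]; rewrite ltr_pdivrMr// => Vh.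
    exists h; split => //; rewrite /g [t + h]addrC (semigroupD (hT j)) ?(ltW h0)//.
    have /HL : 0 <= t < s by rewrite t0.
    rewrite -(ler_pM2l h0); lra.
rewrite /g mulr0 addr0 (semigroup0 (hT j)).
have : q * s <= e.
  by rewrite /q mulrAC ler_pdivrMr// ler_pM2l// lerDl.
lra.
Qed.

Lemma lyapunov_flow_le w x : admissible w -> V (flow T w x) <= V x.
Proof.
elim: w x => //= -[j s] w IH x /andP[/= s0 aw]; apply: le_trans (IH _ aw) _ => /=.
have := @lyapunov_semigroup_decrease j s 0 x s0; rewrite mul0r addr0; apply.
by move=> *; rewrite sqr_ge0.
Qed.

(** The end point z is reached from each point y of the path by a word of
    duration at most h, so |y|^2 >= |z|^2 / A^2: along the path V decreases at
    least at this constant rate. *)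
Lemma lyapunov_flow_decrease (A h : R) w x : 0 < A ->
  (forall v y, admissible v -> duration v <= h ->
    rnorm (flow T v y) <= A * rnorm y) ->
  admissible w -> duration w <= h ->
  A ^+ 2 * V (flow T w x) + duration w * rnorm (flow T w x) ^+ 2 <= A ^+ 2 * V x.
Proof.
move=> A0 HA; have A20 : 0 < A ^+ 2 by rewrite exprn_gt0.
elim: w x => [|[j s] w IH] x; first by rewrite duration_nil mul0r addr0.
move=> /andP[/= s0 aw]; rewrite duration_cons /= => swh.
have wh : duration w <= h by apply: le_trans swh; rewrite lerDr.
have := IH (T j s x) aw wh; set z := flow T w _.
have : V (T j s x) + rnorm z ^+ 2 / A ^+ 2 * s <= V x.
  apply: lyapunov_semigroup_decrease => // t /andP[t0 ts].
  rewrite ler_pdivrMr// mulrC -exprMn ler_sqr ?nnegrE ?mulr_ge0 ?rnorm_ge0 ?(ltW A0)//.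
  have -> : z = flow T ((j, s - t) :: w) (T j t x).
    by rewrite /= -(semigroupD (hT j)) ?subrK ?subr_ge0 ?(ltW ts).
  apply: HA; first by rewrite /= subr_ge0 (ltW ts).
  by rewrite duration_cons/=; lra.
rewrite -(ler_pM2l A20) mulrDr mulrA [_ * (_ / _)]mulrC divfK ?gt_eqF//; lra.
Qed.

(** The last unit of time of a word w of duration at least 1 leads from some y
    to the end point z, with |z|^2 <= A^2 V y <= A^2 V x <= A^2 C |x|^2. The
    constant (1 + C)^2 exceeds both 1 and C. *)
Lemma flow_uniformly_bounded (M omega : R) : 1 <= M -> 0 < omega ->
  flow_bound T M omega ->
  exists2 A, 1 <= A & forall w x, admissible w -> rnorm (flow T w x) <= A * rnorm x.
Proof.
move=> M1 omega0 fb; pose A := M * expR omega.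
have A1 : 1 <= A by rewrite mulr_ege1// -expR0 ler_expR ltW.
have A0 : 0 < A by rewrite (lt_le_trans ltr01).
have HA v y : admissible v -> duration v <= 1 -> rnorm (flow T v y) <= A * rnorm y.
  move=> av dv; apply: (le_trans (fb v av y)).
  rewrite ler_wpM2r ?rnorm_ge0// ler_wpM2l ?(le_trans ler01)// ler_expR.
  by rewrite ler_piMr// ltW.
exists (A * (1 + C)); first by rewrite mulr_ege1// lerDl ltW.
move=> w x aw; have [w1|w1] := leP (duration w) 1.
  apply: (le_trans (HA w x aw w1)); rewrite ler_wpM2r ?rnorm_ge0//.
  by rewrite ler_peMr ?(ltW A0)// lerDl ltW.
have [|w' [v [aw' av dw' dw ->]]] := flow_split hT (r := duration w - 1) aw.
  by rewrite subr_ge0 ltW//= gerBl.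
have dv : duration v = 1 by lra.
have dv1 : duration v <= 1 by rewrite dv.
have := lyapunov_flow_decrease (flow T w' x) A0 HA av dv1.
set z := flow T v _; rewrite dv mul1r => zV.
have Cx0 : 0 <= A * (1 + C) * rnorm x.
  by rewrite mulr_ge0 ?rnorm_ge0// mulr_ge0 ?(ltW A0)// addr_ge0 ?(ltW C_gt0).
rewrite -ler_sqr ?nnegrE ?rnorm_ge0//.
have : rnorm z ^+ 2 <= A ^+ 2 * V x.
  have := V_ge0 z; have := lyapunov_flow_le x aw'; have : 0 < A ^+ 2 by rewrite exprn_gt0.
  by nra.
move/le_trans; apply.
have -> : (A * (1 + C) * rnorm x) ^+ 2 = A ^+ 2 * ((1 + C) ^+ 2 * rnorm x ^+ 2).
  by ring.
rewrite ler_wpM2l ?sqr_ge0//.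
apply: (le_trans (V_le x)); rewrite ler_wpM2r ?sqr_ge0//.
by have := C_gt0; nra.
Qed.

(** Each time h halves the norm, e^(- mu h) = 1/2, and the factor 2 absorbs the
    incomplete last period. *)
Lemma flow_exponential_of_contraction (A h : R) : 1 <= A -> 0 < h ->
  (forall w x, admissible w -> rnorm (flow T w x) <= A * rnorm x) ->
  (forall w x, admissible w -> duration w = h ->
    rnorm (flow T w x) <= 2^-1 * rnorm x) ->
  flow_bound T (2 * A) (- (ln 2 / h)).
Proof.
move=> A1 h0 HA Hh; set mu := ln 2 / h.
have mu0 : 0 < mu by rewrite divr_gt0// ln_gt0// ltr1n.
have A0 : 0 < A by rewrite (lt_le_trans ltr01).
have muh : expR (- mu * h) = 2^-1.
  by rewrite mulNr divfK ?gt_eqF// expRN lnK ?posrE.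
have H n w x : admissible w -> duration w <= n%:R * h ->
    rnorm (flow T w x) <= 2 * A * expR (- mu * duration w) * rnorm x.
  have base v y : admissible v -> duration v <= h ->
      rnorm (flow T v y) <= 2 * A * expR (- mu * duration v) * rnorm y.
    move=> av vh; apply: (le_trans (HA v y av)); rewrite ler_wpM2r ?rnorm_ge0//.
    have : 2^-1 <= expR (- mu * duration v).
      by rewrite -muh ler_expR !mulNr lerN2 ler_wpM2l// ltW.
    rewrite -(ler_pM2l A0); lra.
  elim: n w x => [|n IH] w x aw dw.
    by apply: base => //; rewrite (le_trans dw)// mul0r ltW.
  have [wh|wh] := leP (duration w) h; first exact: base.
  have [|w1 [w2 [aw1 aw2 dw1 dw12 ->]]] := flow_split hT (r := h) aw.
    by rewrite !ltW.
  have dw2 : duration w2 <= n%:R * h.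
    by move: dw; rewrite dw12 dw1 -natr1 mulrDl mul1r addrC lerD2r.
  apply: (le_trans (IH w2 _ aw2 dw2)).
  rewrite dw12 dw1 mulrDr expRD muh.
  have : 0 <= 2 * A * expR (- mu * duration w2).
    by rewrite !mulr_ge0 ?expR_ge0// ltW.
  move=> /ler_wpM2l/(_ _ _ (Hh w1 x aw1 dw1))/le_trans; apply.
  by rewrite le_eqVlt; apply/orP; left; apply/eqP; ring.
move=> w aw x; apply: (H (Num.truncn (duration w / h)).+1) => //.
by rewrite -ler_pdivrMr// ltW// truncnS_gt.
Qed.

(** With the uniform bound A, [lyapunov_flow_decrease] gives
    |w| |flow T w x|^2 <= A^2 C |x|^2, a contraction by 1/2 when
    |w| = 4 A^2 C. *)
Lemma flow_exponentially_stable (M omega : R) : 1 <= M -> 0 < omega ->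
  flow_bound T M omega ->
  exists K mu, [/\ 1 <= K, 0 < mu & flow_bound T K (- mu)].
Proof.
move=> M1 omega0 fb; have [A A1 HA] := flow_uniformly_bounded M1 omega0 fb.
have A0 : 0 < A by rewrite (lt_le_trans ltr01).
pose h := 4 * (A ^+ 2 * C); have h0 : 0 < h by rewrite !mulr_gt0// exprn_gt0.
exists (2 * A), (ln 2 / h); split.
- by lra.
- by rewrite divr_gt0// ln_gt0// ltr1n.
apply: flow_exponential_of_contraction => // w x aw dw.
have dwh : duration w <= h by rewrite dw.
have := lyapunov_flow_decrease x A0 (fun v y av _ => HA v y av) aw dwh.
set z := flow T w x; rewrite dw => zV.
have A20 : 0 < A ^+ 2 by rewrite exprn_gt0.
have Vx : A ^+ 2 * V x <= A ^+ 2 * (C * rnorm x ^+ 2) by rewrite ler_pM2l.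
have Vz : 0 <= A ^+ 2 * V z by rewrite mulr_ge0// ltW.
have x20 : 0 <= 2^-1 * rnorm x by rewrite mulr_ge0 ?rnorm_ge0// invr_ge0.
rewrite -ler_sqr ?nnegrE ?rnorm_ge0// -(ler_pM2l h0) exprMn.
have -> : h * (2^-1 ^+ 2 * rnorm x ^+ 2) = A ^+ 2 * (C * rnorm x ^+ 2).
  by rewrite /h; field.
lra.
Qed.

(** Since c |flow T w x|^2 <= V (flow T w x) <= V x <= C |x|^2, the flow is bounded
    by sqrt (C / c), and 1 + C / c is a larger constant that is at least 1. *)
Lemma flow_bounded_of_coercive (c : R) : 0 < c ->
  (forall x, c * rnorm x ^+ 2 <= V x) -> flow_bound T (1 + C / c) 1.
Proof.
move=> c0 cV w aw x.
have Cc : 0 < C / c by rewrite divr_gt0.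
have z : rnorm (flow T w x) <= (1 + C / c) * rnorm x.
  have Cx0 : 0 <= (1 + C / c) * rnorm x.
    by rewrite mulr_ge0 ?rnorm_ge0// addr_ge0 ?(ltW Cc).
  rewrite -ler_sqr ?nnegrE ?rnorm_ge0// exprMn.
  have : rnorm (flow T w x) ^+ 2 <= C / c * rnorm x ^+ 2.
    rewrite mulrAC ler_pdivlMr// mulrC (le_trans (cV _))//.
    exact: le_trans (lyapunov_flow_le x aw) (V_le x).
  move/le_trans; apply; rewrite ler_wpM2r ?sqr_ge0//; nra.
apply: (le_trans z); rewrite ler_wpM2r ?rnorm_ge0// mul1r ler_peMr//.
  by rewrite addr_ge0 ?ltW.
by rewrite -expR0 ler_expR duration_ge0.
Qed.

End Lyapunov.

(** * The Lyapunov function of an exponentially stable system *)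

Section ConverseLyapunov.
Context {R : realType} {k : scalars} {X : normedModType (scalar_field R k)}.
Context {Q : Type} {T : Q -> R -> X -> X}.
Hypothesis hT : forall j, strongly_continuous_semigroup (T j).
Variables K mu : R.
Hypothesis mu_gt0 : 0 < mu.
Hypothesis flow_decay : flow_bound T K (- mu).
Implicit Types (w : seq (Q * R)) (x y : X).

Definition trajectory_weights x : set R :=
  [set expR (mu * duration w) * rnorm (flow T w x) |
    w in [set w : seq (Q * R) | admissible w]].

(** A norm equivalent to that of X, which each T_j(h) contracts by e^(- mu h). *)
Definition trajectory_norm x : R := sup (trajectory_weights x).

Lemma trajectory_weight_le w x : admissible w ->
  expR (mu * duration w) * rnorm (flow T w x) <= K * rnorm x.
Proof.
move=> aw; rewrite mulrC -ler_pdivlMr ?expR_gt0// -expRN -mulNr mulrAC.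
exact: flow_decay.
Qed.

Lemma trajectory_weights_nonempty x : trajectory_weights x !=set0.
Proof. by exists (rnorm x), [::] => //; rewrite duration_nil mulr0 expR0 mul1r. Qed.

Lemma trajectory_norm_ub w x : admissible w ->
  expR (mu * duration w) * rnorm (flow T w x) <= trajectory_norm x.
Proof.
move=> aw; apply: ub_le_sup; last by exists w.
by exists (K * rnorm x) => _ [v av <-]; exact: trajectory_weight_le.
Qed.

Lemma trajectory_norm_le x (B : R) :
  (forall w, admissible w -> expR (mu * duration w) * rnorm (flow T w x) <= B) ->
  trajectory_norm x <= B.
Proof.
move=> H; apply: ge_sup; first exact: trajectory_weights_nonempty.
by move=> _ [w aw <-]; exact: H.
Qed.

Lemma rnorm_le_trajectory_norm x : rnorm x <= trajectory_norm x.
Proof.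
have := @trajectory_norm_ub [::] x isT.
by rewrite duration_nil mulr0 expR0 mul1r.
Qed.

Lemma trajectory_norm_ge0 x : 0 <= trajectory_norm x.
Proof. exact: le_trans (rnorm_ge0 x) (rnorm_le_trajectory_norm x). Qed.

Lemma trajectory_norm_le_rnorm x : trajectory_norm x <= K * rnorm x.
Proof. by apply: trajectory_norm_le => w; exact: trajectory_weight_le. Qed.

Lemma trajectory_normZ_le a x :
  trajectory_norm (a *: x) <= scalar_abs a * trajectory_norm x.
Proof.
apply: trajectory_norm_le => w aw; rewrite (flowZ hT)// rnormZ mulrCA.
by rewrite ler_wpM2l ?scalar_abs_ge0// trajectory_norm_ub.
Qed.

(** Homogeneity follows from [trajectory_normZ_le] applied to a and to a^-1. *)
Lemma trajectory_normP : is_norm trajectory_norm.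
Proof.
split; first exact: trajectory_norm_ge0.
- move=> x x0; apply: rnorm0_eq0; apply/eqP.
  by rewrite eq_le rnorm_ge0 andbT -x0 rnorm_le_trajectory_norm.
- move=> a x; apply/eqP; rewrite eq_le trajectory_normZ_le/=.
  have [->|a0] := eqVneq a 0.
    by rewrite -real_scalar0 scalar_abs_real_scalar normr0 mul0r trajectory_norm_ge0.
  have := trajectory_normZ_le a^-1 (a *: x); rewrite scalerA mulVf// scale1r.
  move=> /(ler_wpM2l (scalar_abs_ge0 a)).
  by rewrite mulrA scalar_absV// mul1r.
- move=> x y; apply: trajectory_norm_le => w aw; rewrite (flowD hT)//.
  apply: (@le_trans _ _ (expR (mu * duration w) * rnorm (flow T w x) +
      expR (mu * duration w) * rnorm (flow T w y))).
    by rewrite -mulrDr ler_wpM2l ?expR_ge0// ler_rnormD.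
  by rewrite lerD// trajectory_norm_ub.
Qed.

Lemma trajectory_norm_semigroup j (h : R) x : 0 <= h ->
  trajectory_norm (T j h x) <= expR (- (mu * h)) * trajectory_norm x.
Proof.
move=> h0; apply: trajectory_norm_le => w aw.
rewrite expRN mulrC ler_pdivlMl ?expR_gt0//.
have := @trajectory_norm_ub ((j, h) :: w) x; rewrite /= h0 => /(_ aw).
by rewrite duration_cons/= mulrDr expRD -mulrA [X in _ * X]mulrC.
Qed.

Definition trajectory_lyapunov x : R := trajectory_norm x ^+ 2 / (2 * mu).

Let mu2 : 0 < 2 * mu. Proof. by rewrite mulr_gt0. Qed.

Lemma sqrt_trajectory_lyapunovP :
  is_norm (fun x => Num.sqrt (trajectory_lyapunov x)).
Proof.
have e x : Num.sqrt (trajectory_lyapunov x) =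
    trajectory_norm x * Num.sqrt (2 * mu)^-1.
  by rewrite sqrtrM ?sqr_ge0// sqrtr_sqr ger0_norm ?trajectory_norm_ge0.
have s0 : 0 < Num.sqrt (2 * mu)^-1 by rewrite sqrtr_gt0 invr_gt0.
have [N0 Neq0 NZ ND] := trajectory_normP; split.
- by move=> x; exact: sqrtr_ge0.
- by move=> x; rewrite e => /eqP; rewrite mulf_eq0 (gt_eqF s0) orbF => /eqP /Neq0.
- by move=> a x; rewrite !e NZ mulrA.
- by move=> x y; rewrite !e -mulrDl ler_wpM2r// ltW.
Qed.

(** From e^(- u) <= 1 / (1 + u) with u = 2 mu h, the difference quotient is at most
    - N^2 / (1 + u), where N = [trajectory_norm x] >= |x|. *)
Lemma trajectory_lyapunov_decay : decay_condition T trajectory_lyapunov.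
Proof.
move=> j x; apply/liminf_right_leP => e d e0 d0.
pose N2 := trajectory_norm x ^+ 2; have N20 : 0 <= N2 by exact: sqr_ge0.
(* The choice of h ensures u N^2 < e, and N^2 - N^2 / (1 + u) <= u N^2. *)
pose b := 2 * mu * N2 + 1; have b0 : 0 < b by rewrite ltr_wpDl// mulr_ge0// ltW.
pose h := Num.min (d / 2) (e / b).
have h0 : 0 < h by rewrite lt_min !divr_gt0.
have hd : h < d by rewrite gt_min ltr_pdivrMr// mulr_natr mulr2n ltrDl d0.
have he : h * b <= e by rewrite -ler_pdivlMr// ge_min lexx orbT.
exists h; split => //.
have u0 : 0 < 1 + 2 * mu * h by rewrite ltr_pwDl// mulr_ge0 ?ltW.
have Th : trajectory_norm (T j h x) ^+ 2 <= N2 / (1 + 2 * mu * h).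
  apply: (@le_trans _ _ (expR (- (2 * mu * h)) * N2)); last first.
    rewrite mulrC ler_wpM2l// expRN lef_pV2 ?posrE ?expR_gt0//.
    exact: expR_ge1Dx.
  have -> : expR (- (2 * mu * h)) = expR (- (mu * h)) ^+ 2.
    by rewrite expr2 -expRD; congr expR; ring.
  rewrite /N2 -exprMn ler_sqr ?nnegrE ?trajectory_norm_ge0//.
    by apply: trajectory_norm_semigroup; exact: ltW.
  by rewrite mulr_ge0 ?expR_ge0 ?trajectory_norm_ge0.
have xN : rnorm x ^+ 2 <= N2.
  by rewrite ler_sqr ?nnegrE ?rnorm_ge0 ?trajectory_norm_ge0 ?rnorm_le_trajectory_norm.
rewrite ltr_pdivrMr// /trajectory_lyapunov -/N2 -mulrBl ltr_pdivrMr//.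
have : N2 / (1 + 2 * mu * h) - N2 < (- rnorm x ^+ 2 + e) * h * (2 * mu).
  have -> : (- rnorm x ^+ 2 + e) * h * (2 * mu) =
      (- rnorm x ^+ 2 + e) * (2 * mu * h) by ring.
  set u := 2 * mu * h in u0 *.
  have u_gt0 : 0 < u by rewrite mulr_gt0.
  have uN2 : u * N2 < e.
    apply: lt_le_trans he; have -> : h * b = u * N2 + h by rewrite /b /u; ring.
    by rewrite ltrDl.
  have : (- N2 + e) * u <= (- rnorm x ^+ 2 + e) * u.
    by rewrite ler_pM2r// lerD2r lerN2.
  apply: lt_le_trans; rewrite ltrBlDr ltr_pdivrMr//.
  have -> : ((- N2 + e) * u + N2) * (1 + u) = N2 + (u * (e - u * N2) + e * u ^+ 2).
    by ring.
  by rewrite ltrDl addr_gt0 ?mulr_gt0 ?exprn_gt0 ?subr_gt0.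
lra.
Qed.

End ConverseLyapunov.

Theorem mainTheorem1 (R : realType) (k : scalars)
    (X : completeNormedModType (scalar_field R k)) (Q : countType)
    (T : Q -> R -> X -> X)
    (hT : forall j, strongly_continuous_semigroup (T j)) :
  let condA :=
    exists K mu : R, [/\ 1 <= K, 0 < mu & exponential_bound T K (- mu)] in
  let condB :=
    (exists M omega : R,
       [/\ 1 <= M, 0 < omega & exponential_bound T M omega]) /\
    (exists V : X -> R,
       [/\ forall x, 0 <= V x,
           is_norm (fun x => Num.sqrt (V x)),
           exists2 C : R, 0 < C & forall x, V x <= C * rnorm x ^+ 2 &
           decay_condition T V]) in
  let condC :=
    exists V : X -> R,
      [/\ forall x, 0 <= V x,
          is_norm (fun x => Num.sqrt (V x)),
          exists c C : R, [/\ 0 < c, 0 < C &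
            forall x, c * rnorm x ^+ 2 <= V x <= C * rnorm x ^+ 2] &
          decay_condition T V] in
  (condA <-> condB) /\ (condB <-> condC).
Proof.
move=> condA condB condC.
have AC : condA -> condC.
  move=> [K [mu [K1 mu0 /(exponential_boundE hT _ K1) fb]]].
  have mu2 : 0 < 2 * mu by rewrite mulr_gt0.
  have K0 : 0 < K by rewrite (lt_le_trans ltr01).
  exists (trajectory_lyapunov (T := T) mu); split.
  - by move=> x; rewrite divr_ge0 ?sqr_ge0// ltW.
  - exact: sqrt_trajectory_lyapunovP fb.
  - exists (2 * mu)^-1, (K ^+ 2 / (2 * mu)); split.
    + by rewrite invr_gt0.
    + by rewrite divr_gt0// exprn_gt0.
    + move=> x; rewrite mulrC ler_pM2r ?invr_gt0// mulrAC ler_pM2r ?invr_gt0//.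
      rewrite -exprMn !ler_sqr ?nnegrE ?rnorm_ge0 ?(trajectory_norm_ge0 fb)//.
        by rewrite (rnorm_le_trajectory_norm fb) (trajectory_norm_le_rnorm fb).
      by rewrite mulr_ge0 ?rnorm_ge0 ?ltW.
  - exact: trajectory_lyapunov_decay fb.
have CB : condC -> condB.
  move=> [V [V0 VN [c [C [c0 C0 cVC]]] Vd]].
  have VC x : V x <= C * rnorm x ^+ 2 by have /andP[] := cVC x.
  have cV x : c * rnorm x ^+ 2 <= V x by have /andP[] := cVC x.
  have M1 : 1 <= 1 + C / c by rewrite lerDl divr_ge0 ?ltW.
  split; last by exists V; split => //; exists C.
  exists (1 + C / c), 1; split => //; apply/(exponential_boundE hT _ M1).
  exact: (flow_bounded_of_coercive hT V0 VN C0 VC Vd).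
have BA : condB -> condA.
  move=> [[M [omega [M1 omega0 /(exponential_boundE hT _ M1) fb]]]].
  move=> [V [V0 VN [C C0 VC] Vd]].
  have [K [mu [K1 mu0 fb']]] :=
    flow_exponentially_stable hT V0 VN C0 VC Vd M1 omega0 fb.
  by exists K, mu; split => //; apply/(exponential_boundE hT _ K1).
split; split; auto.
Qed.
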